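(* Let $\mathcal{S}$ be a finite connected poset that is not in Class B. Let $P_{a,1},\ldots,P_{a,m},P_{b,1},\ldots,P_{b,n}$ be probability measures on $S$ satisfying $$P_{a,i}\preceq P_{b,j}\quad\text{for all } i=1,\ldots,m \text{ and all } j=1,\ldots,n.$$ Then there exists a probability measure $P_0$ on $S$ such that $$P_{a,i}\preceq P_0\preceq P_{b,j}\quad\text{for all } i=1,\ldots,m \text{ and all } j=1,\ldots,n.$$
   Context: All posets are finite. For a poset $\mathcal{S}$ with ground set $S$: $y$ covers $x$ if $x<y$ and no $z\in S$ satisfies $x<z<y$. The cover graph of $\mathcal{S}$ is the undirected graph on $S$ whose edges are the pairs $\{x,y\}$ such that one of $x,y$ covers the other. $\mathcal{S}$ is connected if its cover graph is connected; it has a cycle if its cover graph contains a cycle (in the usual graph-theoretic sense). An induced subposet of $\mathcal{S}$ is a subset of $S$ with the restricted order; ''$\mathcal{S}$ has an induced $\mathcal{Q}$'' means some induced subposet of $\mathcal{S}$ is isomorphic to $\mathcal{Q}$. The bowtie is the poset on four elements $x_0,x_1,y_0,y_1$ whose only strict relations are $x_i<y_j$ for all $i,j\in\{0,1\}$. A connected poset $\mathcal{S}$ is in Class B if $\mathcal{S}$ has either a cycle or an induced bowtie. An up-set of $\mathcal{S}$ is a set $U\subseteq S$ such that $x\in U$ and $x\le y$ imply $y\in U$. For probability measures $P_1,P_2$ on $S$, write $P_1\preceq P_2$ if $P_1(U)\le P_2(U)$ for every up-set $U$ of $\mathcal{S}$. *)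

(* Defs.v *)
From HB Require Import structures.
From mathcomp Require Import all_boot all_order all_algebra.
From mathcomp Require Import all_classical all_reals all_analysis.

Set Implicit Arguments.
Unset Strict Implicit.
Unset Printing Implicit Defensive.

Import Order.TTheory.
Local Open Scope classical_set_scope.

(* The full power set of T as a sigma-algebra. The library's measurable types
   are pointed, hence the parameter x0, which plays no other role. *)
Definition discrete_space (T : choiceType) (x0 : T) : Type := T.

HB.instance Definition _ (T : choiceType) (x0 : T) :=
  Choice.on (discrete_space x0).
HB.instance Definition _ (T : choiceType) (x0 : T) :=
  isPointed.Build (discrete_space x0) x0.
HB.instance Definition _ (T : choiceType) (x0 : T) :=
  @isMeasurable.Build default_measure_display (discrete_space x0)
    (@discrete_measurable T) (@discrete_measurable0 T)
    (@discrete_measurableC T) (@discrete_measurableU T).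

Section Posets.
Context {d : Order.disp_t}.
Implicit Type S : finPOrderType d.

Definition covers S (y x : S) : bool :=
  (x < y)%O && [forall z : S, ~~ ((x < z)%O && (z < y)%O)].

Definition cover_graph S : rel S := [rel x y | covers x y || covers y x].

Definition connected_poset S : Prop := forall x y : S, connect (@cover_graph S) x y.

(* ucycle alone also admits sequences of length at most 2, e.g. a single edge
   walked back and forth. *)
Definition has_cycle S : Prop :=
  exists2 c : seq S, (2 < size c)%N & ucycle (@cover_graph S) c.

Definition has_induced S {d' : Order.disp_t} (Q : finPOrderType d') : Prop :=
  exists (A : {set S}) (f : Q -> {x : S | x \in A}),
    bijective f /\ forall p q : Q, (val (f p) <= val (f q))%O = (p <= q)%O.

Definition up_set S (U : set S) : Prop :=
  forall x y : S, U x -> (x <= y)%O -> U y.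

End Posets.

(* (false, i) stands for x_i and (true, j) for y_j. *)
Definition bowtie : Type := (bool * bool)%type.
HB.instance Definition _ := Finite.on bowtie.

Definition bowtie_le (p q : bowtie) : bool := (p == q) || (~~ p.1 && q.1).

Fact bowtie_le_refl : reflexive bowtie_le.
Proof. by move=> p; rewrite /bowtie_le eqxx. Qed.

Fact bowtie_le_anti : antisymmetric bowtie_le.
Proof. by move=> [[] []] [[] []]. Qed.

Fact bowtie_le_trans : transitive bowtie_le.
Proof. by move=> [[] []] [[] []] [[] []]. Qed.

Fact bowtie_display : Order.disp_t. Proof. exact: Order.Disp tt tt. Qed.

HB.instance Definition _ := Order.Le_isPOrder.Build bowtie_display bowtie
  bowtie_le_refl bowtie_le_anti bowtie_le_trans.

Definition classB {d : Order.disp_t} (S : finPOrderType d) : Prop :=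
  connected_poset S /\ (has_cycle S \/ has_induced S bowtie).

Definition stoch_le {d : Order.disp_t} {S : finPOrderType d} {R : realType}
    {x0 : S} (P1 P2 : probability (discrete_space x0) R) : Prop :=
  forall U : set S, up_set U -> (P1 U <= P2 U)%E.

(* Main.v *)
(* The cover graph is a tree. Removing an edge e = (x, y) splits it into two
   parts, and the part C_e containing y is an up-set. Any function g on S is,
   up to a constant, the sum over the edges of (g y - g x) 1_{C_e}; hence
   P <= Q stochastically iff P(C_e) <= Q(C_e) for all e, and a signed measure of
   total mass 1 is determined by its values z_e on the C_e, which are arbitrary.
   Take z_e = min_j P_{b,j}(C_e) if the elements below y form a chain and
   z_e = max_i P_{a,i}(C_e) otherwise. Since there is no bowtie, a vertex v has
   at most one lower cover if the elements below v form a chain, and at most one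
   upper cover otherwise. Choosing the P_{b,j} (resp. P_{a,i}) that is extremal
   at this cover, one finds P_0(v) >= P_{b,j}(v) (resp. P_0(v) >= P_{a,i}(v)),
   so P_0 is nonnegative. *)
Require Import Defs.
From HB Require Import structures.
From mathcomp Require Import all_boot all_order all_algebra.
From mathcomp Require Import all_classical all_reals all_analysis.

Set Implicit Arguments.
Unset Strict Implicit.
Unset Printing Implicit Defensive.

(** * Cover edges and the sides of a deleted edge *)

Section TreePosets.
Import Order.TTheory GRing.Theory Num.Theory.
Local Open Scope ring_scope.

Context {d : Order.disp_t} {S : finPOrderType d}.
Implicit Types (e : S * S) (x y u v w : S).

(** Edges are oriented from the lower to the upper end, so a sum over [edge] counts each undirected
    edge once. *)
Definition edge e := covers e.2 e.1.

Definition del_edge e : rel S :=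
  [rel u w | [&& cover_graph u w, (u, w) != e & (w, u) != e]].

(** The set C_e: the component of the top of [e] once that edge is deleted in both directions. *)
Definition upper_side e : {set S} := [set w | connect (del_edge e) e.2 w].

Lemma covers_lt x y : covers y x -> (x < y)%O.
Proof. by case/andP. Qed.

Lemma cover_graph_sym : symmetric (@cover_graph d S).
Proof. by move=> u w; rewrite /cover_graph /= orbC. Qed.

Lemma del_edge_sym e : symmetric (del_edge e).
Proof.
move=> u w; apply/idP/idP => /and3P[g n1 n2]; apply/and3P; split=> //;
  by rewrite -/(cover_graph _ _) cover_graph_sym.
Qed.

(** Induction on the size of the interval from [x] to [y]: if [y] does not cover [x], some [z]
    strictly between splits it into two smaller intervals. *)
Lemma cover_closed_up_set (U : {pred S}) :
  (forall x y, covers y x -> x \in U -> y \in U) ->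
  forall x y, (x <= y)%O -> x \in U -> y \in U.
Proof.
move=> clU x y.
have [n] := ubnP #|[set z | (x <= z <= y)%O]|.
elim: n => // n IHn in x y *; rewrite ltnS => le_n xy xU.
have [<- //|neq_xy] := eqVneq x y.
have lt_xy : (x < y)%O by rewrite lt_neqAle neq_xy.
have [/clU -> //|] := boolP (covers y x).
rewrite /covers lt_xy /= negb_forall => /existsP[z].
rewrite negbK => /andP[xz zy].
have IHlt u w : (x <= u)%O -> (u <= w)%O -> (w <= y)%O ->
    (x < u)%O || (w < y)%O -> u \in U -> w \in U.
  move=> xu uw wy lt_uw; apply: IHn => //; apply: leq_trans le_n.
  apply: proper_card; apply/properP; split.
    apply/fintype.subsetP => t; rewrite !inE => /andP[ut tw].
    by rewrite (le_trans xu ut) (le_trans tw wy).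
  case/orP: lt_uw => [xu'|wy'].
    by exists x; rewrite !inE ?lexx ?xy // (lt_geF xu').
  by exists y; rewrite !inE ?lexx ?xy // (lt_geF wy') andbF.
by apply: (IHlt z y) (IHlt x z _ _ _ _ xU);
  rewrite ?xz ?zy ?orbT ?(ltW xz) ?(ltW zy).
Qed.

Lemma upper_side_cover e x y : edge e -> covers y x -> (x, y) != e ->
  (x \in upper_side e) = (y \in upper_side e).
Proof.
move=> ce cyx ne; rewrite !inE.
apply: (same_connect_r (sym_connect_sym (del_edge_sym e))).
apply: connect1; apply/and3P; split; [by apply/orP; right | by [] |].
apply: contraTneq ce => /= <-; rewrite /edge /=.
by apply/negP => /covers_lt; rewrite lt_gtF // covers_lt.
Qed.

Lemma upper_side_top e : e.2 \in upper_side e.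
Proof. by rewrite inE connect0. Qed.

Lemma upper_side_up_set e : edge e -> up_set [set` upper_side e]%classic.
Proof.
move=> ce x y xe xy; apply: cover_closed_up_set xy xe => {}x {}y cyx xe.
have [<-|ne] := eqVneq (x, y) e; first exact: upper_side_top.
by rewrite -(upper_side_cover ce cyx ne).
Qed.

Lemma sum_indicator (R : pzSemiRingType) (r : S -> R) (A : {set S}) :
  \sum_(v in A) r v = \sum_v r v * (v \in A)%:R.
Proof.
rewrite big_mkcond; apply: eq_bigr => v _.
by case: ifP; rewrite ?mulr1 ?mulr0.
Qed.

Hypothesis acyclic : ~ has_cycle S.

(** A simple path from top to bottom avoiding [e] would close up with [e] to a cycle. *)
Lemma upper_side_bot e : edge e -> e.1 \notin upper_side e.
Proof.
move=> ce; apply/negP; rewrite inE => /connectP[p].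
case/shortenP=> {}p pth unq _ last_p; apply: acyclic.
exists (e.2 :: p).
  (* The cycle has at least three vertices: an empty path would identify the two ends, a single step
     would be [e] itself. *)
  case: p => [|z [|]] //= in pth unq last_p *.
    by move: (covers_lt ce); rewrite last_p ltxx.
  case: e => x y in ce pth unq last_p *.
  case/andP: pth => /and3P[_ _]; move: last_p => /= <-.
  by rewrite eqxx.
apply/andP; split=> //; rewrite /= rcons_path -last_p.
apply/andP; split; last by apply/orP; right.
by apply: sub_path pth => u w /and3P[].
Qed.

(** * Summation by parts over the edges of the tree *)

Hypothesis connS : connected_poset S.

Lemma cover_graph_const (T : Type) (h : S -> T) :
  (forall x y, covers y x -> h x = h y) -> forall u w, h u = h w.
Proof.
move=> hc u w; have /connectP[p pth ->] := connS u w.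
elim: p u pth => //= z p IHp u /andP[uz /IHp <-].
by case/orP: uz => /hc ->.
Qed.

(* The difference of the two sides below is constant along each edge: crossing
   an edge only changes the membership in the upper side of that edge. *)
Lemma edge_expansion (R : zmodType) (g : S -> R) u w :
  g u - g w = \sum_(e | edge e)
    ((g e.2 - g e.1) *+ (u \in upper_side e) -
     (g e.2 - g e.1) *+ (w \in upper_side e)).
Proof.
pose h v := g v - \sum_(e | edge e) (g e.2 - g e.1) *+ (v \in upper_side e).
suff /(_ u w) : forall u w, h u = h w.
  rewrite /h sumrB; set su := (X in g u - X); set sw := (X in g w - X).
  move=> /(congr1 (fun t => t + su - g w)).
  by rewrite subrK => ->; rewrite -[LHS]addrA addrC addrA subrK.
apply: cover_graph_const => x y cyx.
have ce : edge (x, y) by [].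
rewrite /h (bigD1 (x, y)) //= [in RHS](bigD1 (x, y)) //=.
rewrite (negPf (upper_side_bot ce)) (upper_side_top (x, y)) add0r.
rewrite mulr1n opprD addrA opprB subrKC; congr (_ - _).
by apply: eq_bigr => e /andP[ee ne]; rewrite (upper_side_cover ee cyx) // eq_sym.
Qed.

(** Expand [g] about a base vertex [w]; the terms that do not depend on [v] vanish because [r] has
    total mass 0. *)
Lemma edge_summation (R : realFieldType) (r g : S -> R) :
  \sum_v r v = 0 ->
  \sum_v r v * g v =
  \sum_(e | edge e) (g e.2 - g e.1) * \sum_(v in upper_side e) r v.
Proof.
move=> r0; have [w _|S0] := pickP [pred v : S | true]; last first.
  rewrite !big1 // => [[x y]|v]; last by have := S0 v.
  by have := S0 x.
transitivity (\sum_v r v * (g v - g w)).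
  under [in RHS]eq_bigr do rewrite mulrBr.
  by rewrite sumrB -mulr_suml r0 mul0r subr0.
under eq_bigr do rewrite (edge_expansion g _ w) mulr_sumr.
rewrite exchange_big; apply: eq_bigr => e ee /=.
under eq_bigr do rewrite mulrBr.
rewrite sumrB -mulr_suml r0 mul0r subr0 mulr_sumr [RHS]big_mkcond /=.
by apply: eq_bigr => v _; case: ifP; rewrite ?mulr1n ?mulr0n ?mulr0 // mulrC.
Qed.

(* The masses p arise from q by letting f e flow upwards through each edge e. *)
Lemma exists_mass (R : realFieldType) (q : S -> R) (z : S * S -> R) :
  exists2 p : S -> R, \sum_v p v = \sum_v q v &
    forall e, edge e -> \sum_(v in upper_side e) p v = z e.
Proof.
pose f e := z e - \sum_(v in upper_side e) q v.
pose p v := q v + \sum_(e | edge e) (f e *+ (v == e.2) - f e *+ (v == e.1)).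
(* The test function 1 will give the total mass, and the indicator of [upper_side e] the value
   [z e], since that indicator jumps only along [e]. *)
have pE g : \sum_v p v * g v =
    \sum_v q v * g v + \sum_(e | edge e) f e * (g e.2 - g e.1).
  have dE e : \sum_v (f e *+ (v == e.2) - f e *+ (v == e.1)) * g v =
      f e * (g e.2 - g e.1).
    have d1 x : \sum_v (f e *+ (v == x)) * g v = f e * g x.
      rewrite (bigD1 x) //= eqxx mulr1n big1 ?addr0 // => v /negPf ->.
      by rewrite mulr0n mul0r.
    under eq_bigr do rewrite mulrBl.
    by rewrite sumrB !d1 mulrBr.
  under eq_bigr do rewrite mulrDl mulr_suml.
  rewrite big_split exchange_big; congr (_ + _).
  by apply: eq_bigr => e _; rewrite -dE.
exists p.
  have := pE (fun=> 1); under eq_bigr do rewrite mulr1.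
  under [X in _ = X + _]eq_bigr do rewrite mulr1.
  by move=> ->; rewrite [X in _ + X]big1 ?addr0 // => e _; rewrite subrr mulr0.
move=> e ee; rewrite sum_indicator pE -sum_indicator (bigD1 e) //=.
rewrite upper_side_top (negPf (upper_side_bot ee)).
rewrite subr0 mulr1 /f addrA subrKC [X in _ + X]big1 ?addr0 //.
move=> [x y] /andP[cyx ne] /=.
by rewrite (upper_side_cover ee cyx ne) subrr mulr0.
Qed.

(** Pair [q - p] with the indicator of [U]: it does not decrease along any edge, so every term of
    the edge sum is nonnegative. *)
Lemma up_set_le (R : realFieldType) (p q : S -> R) (U : {set S}) :
  \sum_v p v = \sum_v q v ->
  (forall e, edge e -> \sum_(v in upper_side e) p v <= \sum_(v in upper_side e) q v) ->
  (forall x y, x \in U -> (x <= y)%O -> y \in U) ->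
  \sum_(v in U) p v <= \sum_(v in U) q v.
Proof.
move=> pq le_pq upU; rewrite -subr_ge0 -sumrB.
rewrite sum_indicator edge_summation; last by rewrite sumrB pq subrr.
apply: sumr_ge0 => e ee; apply: mulr_ge0; last by rewrite sumrB subr_ge0 le_pq.
rewrite subr_ge0 ler_nat.
by have [/upU->|] := boolP (e.1 \in U); rewrite ?(ltW (covers_lt ee)).
Qed.

(** Summation by parts against the indicator of [v], which changes only along the edges at [v]. *)
Lemma mass_diff (R : realFieldType) (p q : S -> R) v :
  \sum_v p v = \sum_v q v ->
  p v - q v =
    \sum_(e | edge e && (e.2 == v)) \sum_(w in upper_side e) (p w - q w) -
    \sum_(e | edge e && (e.1 == v)) \sum_(w in upper_side e) (p w - q w).
Proof.
move=> pq; have := @edge_summation R (fun w => p w - q w) (fun w => (w == v)%:R).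
rewrite sumrB pq subrr => /(_ erefl).
rewrite (bigD1 v) //= eqxx mulr1 big1 ?addr0 => [->|w /negPf->]; last by rewrite mulr0.
under eq_bigr do rewrite mulrBl.
rewrite sumrB; congr (_ - _); rewrite [RHS]big_mkcondr /=; apply: eq_bigr => e _;
  by case: eqP; rewrite ?mul1r ?mul0r.
Qed.


(** * Covers at a vertex and bowties *)

Lemma lower_cover_inj e e' :
  edge e -> edge e' -> e.2 = e'.2 -> (e.1 >=< e'.1)%O -> e = e'.
Proof.
case: e e' => [x v] [x' v'] /= c + ev; rewrite -{}ev => {v'} c'.
have no_between t t' : covers v t -> covers v t' -> ~~ (t < t')%O.
  move=> /andP[_ /forallP/(_ t')] + /covers_lt lt'.
  by rewrite lt' andbT.
case: comparableP => // [lt|lt|->] //; by rewrite (negPf (no_between _ _ _ _)) in lt.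
Qed.

Lemma upper_cover_inj e e' :
  edge e -> edge e' -> e.1 = e'.1 -> (e.2 >=< e'.2)%O -> e = e'.
Proof.
case: e e' => [v y] [v' y'] /= c + ev; rewrite -{}ev => {v'} c'.
have no_between t t' : covers t v -> covers t' v -> ~~ (t < t')%O.
  move=> /covers_lt lt /andP[_ /forallP/(_ t)].
  by rewrite lt.
case: comparableP => // [lt|lt|->] //; by rewrite (negPf (no_between _ _ _ _)) in lt.
Qed.

(** All cross relations pass through [v]; none is reversed, since [y <= x] would give
    [x' <= v <= y <= x], making [x] and [x'] comparable. *)
Lemma bowtie_through x x' y y' v :
  (x >< x')%O -> (y >< y')%O -> (x <= v)%O -> (x' <= v)%O ->
  (v <= y)%O -> (v <= y')%O -> has_induced S bowtie.
Proof.
move=> nx ny xv x'v vy vy'.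
pose f (p : bowtie) := if p.1 then if p.2 then y' else y else if p.2 then x' else x.
have fE p q : (f p <= f q)%O = (p <= q)%O.
  have nle (a b : S) : (a >< b)%O -> ((a <= b)%O = false) * ((b <= a)%O = false).
    by rewrite /Order.comparable negb_or => /andP[/negPf-> /negPf->].
  have nge (a a' b : S) : (a >< a')%O -> (a <= v)%O -> (a' <= v)%O -> (v <= b)%O ->
      (b <= a)%O = false.
    move=> naa' av a'v vb; apply/negP => ba.
    by have := (nle _ _ naa').2; rewrite (le_trans a'v (le_trans vb ba)).
  have sx : (x' >< x)%O by rewrite comparable_sym.
  case: p q => [[] []] [[] []]; rewrite /f /= ?lexx ?(nle _ _ nx) ?(nle _ _ ny)
    ?(le_trans xv vy) ?(le_trans xv vy') ?(le_trans x'v vy) ?(le_trans x'v vy') //.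
  - exact: nge sx _ _ _.
  - exact: nge nx _ _ _.
  - exact: nge sx _ _ _.
  - exact: nge nx _ _ _.
have f_inj : injective f.
  by move=> p q fpq; apply/le_anti; rewrite -!fE fpq lexx.
exists (f @: [set: bowtie]%SET), (fun p => exist _ (f p) (imset_f f (finset.in_setT p))).
split=> //.
apply: inj_card_bij => [p q /(congr1 val) /f_inj //|].
by rewrite card_sig card_imset // cardsT.
Qed.

Hypothesis no_bowtie : ~ has_induced S bowtie.

Definition down_chain v :=
  [forall x, forall x', (x <= v)%O && (x' <= v)%O ==> (x >=< x')%O].

Lemma upper_covers_comparable v y y' :
  ~~ down_chain v -> (v <= y)%O -> (v <= y')%O -> (y >=< y')%O.
Proof.
rewrite negb_forall => /existsP[x]; rewrite negb_forall => /existsP[x'].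
rewrite negb_imply => /andP[/andP[xv x'v] nx] vy vy'.
apply/negPn/negP => ny; exact/no_bowtie/(bowtie_through nx ny xv x'v vy vy').
Qed.

Lemma down_chain_le x y : (x <= y)%O -> down_chain y -> down_chain x.
Proof.
move=> xy /forallP cy; apply/forallP => u; apply/forallP => w.
apply/implyP => /andP[ux wx].
by have /forallP/(_ w)/implyP := cy u; apply; rewrite (le_trans ux xy) (le_trans wx xy).
Qed.

(** * Choice of the edge values and nonnegativity of the masses *)

Lemma exists_mass_between (R : realFieldType) m n (i0 : 'I_m) (j0 : 'I_n)
    (pa : 'I_m -> S -> R) (pb : 'I_n -> S -> R) :
  (forall i v, 0 <= pa i v) -> (forall i, \sum_v pa i v = 1) ->
  (forall j v, 0 <= pb j v) -> (forall j, \sum_v pb j v = 1) ->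
  (forall i j e, edge e ->
    \sum_(v in upper_side e) pa i v <= \sum_(v in upper_side e) pb j v) ->
  exists p : S -> R, [/\ forall v, 0 <= p v, \sum_v p v = 1 &
    forall i j e, edge e ->
      \sum_(v in upper_side e) pa i v <= \sum_(v in upper_side e) p v <=
      \sum_(v in upper_side e) pb j v].
Proof.
move=> pa0 pa1 pb0 pb1 le_ab.
pose a i e := \sum_(v in upper_side e) pa i v.
pose b j e := \sum_(v in upper_side e) pb j v.
pose imax e := [arg max_(i > i0) a i e]%O.
pose jmin e := [arg min_(j < j0) b j e]%O.
have a_max i e : a i e <= a (imax e) e by rewrite /imax; case: arg_maxP => // k _; apply.
have b_min j e : b (jmin e) e <= b j e by rewrite /jmin; case: arg_minP => // k _; apply.
pose z e := if down_chain e.2 then b (jmin e) e else a (imax e) e.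
have az i e : edge e -> a i e <= z e.
  by move=> ee; rewrite /z; case: ifP => // _; apply: le_ab.
have zb j e : edge e -> z e <= b j e.
  by move=> ee; rewrite /z; case: ifP => // _; apply: le_ab.
(* The starting masses [pa i0] serve only to fix the total mass at 1. *)
have [p p1 pz] := exists_mass (pa i0) z; rewrite pa1 in p1.
exists p; split=> // [v|i j e ee]; last by rewrite pz // az ?zb.
have diff_b j := mass_diff v (etrans p1 (esym (pb1 j))).
have diff_a i := mass_diff v (etrans p1 (esym (pa1 i))).
have [cv|ncv] := boolP (down_chain v).
(* At most one edge has top [v], so a single [j] attains all minima there; without such an edge [j0]
   is taken. *)
- have [j jP] : exists j, forall e, edge e -> e.2 = v -> z e = b j e.
    have [[x y] /andP[/= ee /eqP eqv]|none] := pickP [pred e | edge e && (e.2 == v)].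
      exists (jmin (x, y)) => e' ee' e'v.
      have -> : e' = (x, y).
        apply: lower_cover_inj => //=; first by rewrite eqv.
        have /forallP/(_ e'.1)/forallP/(_ x)/implyP := cv; apply.
        by rewrite -{1}e'v -eqv !ltW ?covers_lt.
      by rewrite /z /= eqv cv.
    by exists j0 => e ee ev; have := none e; rewrite /= ee ev eqxx.
  (* The edges below [v] cancel and those above contribute with the right sign, so [p v] is at least
     [pb j v]. *)
  apply: le_trans (pb0 j v) _; rewrite -subr_ge0 diff_b [X in X - _]big1 ?sub0r.
    rewrite oppr_ge0; apply: sumr_le0 => e /andP[ee _].
    by rewrite sumrB subr_le0 pz // zb.
  by move=> e /andP[ee /eqP ev]; rewrite sumrB pz // (jP e) // subrr.
- have [i iP] : exists i, forall e, edge e -> e.1 = v -> z e = a i e.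
    have [[x y] /andP[/= ee /eqP eqv]|none] := pickP [pred e | edge e && (e.1 == v)].
      exists (imax (x, y)) => e' ee' e'v.
      have -> : e' = (x, y).
        apply: upper_cover_inj => //=; first by rewrite eqv.
        apply: (upper_covers_comparable ncv).
          by rewrite -e'v ltW ?covers_lt.
        by rewrite -eqv ltW ?covers_lt.
      (* Chains pass to smaller elements, so the upper end [y] fails the chain condition as [v]
         does, and [z] takes the maximum on this edge. *)
      rewrite /z /= ifN //; apply: contra ncv; apply: down_chain_le.
      by rewrite -eqv ltW ?covers_lt.
    by exists i0 => e ee ev; have := none e; rewrite /= ee ev eqxx.
  apply: le_trans (pa0 i v) _; rewrite -subr_ge0 diff_a [X in _ - X]big1 ?subr0.
    apply: sumr_ge0 => e /andP[ee _].
    by rewrite sumrB subr_ge0 pz // az.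
  by move=> e /andP[ee /eqP ev]; rewrite sumrB pz // (iP e) // subrr.
Qed.

End TreePosets.

(** * Probability measures as mass functions *)

Section DiscreteProbability.
Import Order.TTheory GRing.Theory Num.Theory.
Local Open Scope ring_scope.
Local Open Scope classical_set_scope.

Context {R : realType} {T : finType} {x0 : T}.

Definition mass (P : probability (discrete_space x0) R) (v : T) : R := fine (P [set v]).

Lemma mass_ge0 P v : 0 <= mass P v.
Proof. by apply: fine_ge0; apply: measure_ge0. Qed.

Lemma probability_mass (P : probability (discrete_space x0) R) (A : {set T}) :
  P [set` A] = (\sum_(v in A) mass P v)%:E.
Proof.
have -> : [set` A] = \bigcup_(v in [set` A]) [set v : discrete_space x0].
  by apply/seteqP; split=> [v Av|v [w Aw ->]] //; exists v.
rewrite measure_fin_bigcup //; last by move=> u w _ _ [t [-> ->]].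
have -> : [set` A] = [set` enum A] by apply/seteqP; split=> v /=; rewrite mem_enum.
rewrite -fsbig_seq ?enum_uniq // big_enum /= -sumEFin.
by apply: eq_big => [v|v _]; rewrite ?andbT // fineK // fin_num_measure.
Qed.

Lemma sum_mass P : \sum_v mass P v = 1.
Proof.
apply: EFin_inj; rewrite -(probability_setT P).
have -> : [set: discrete_space x0] = [set` [set: T]%SET].
  by apply/seteqP; split=> // v _ /=; rewrite inE.
by rewrite probability_mass; under [in RHS]eq_bigl do rewrite inE.
Qed.

Lemma mass_probability (p : T -> R) :
  (forall v, 0 <= p v) -> \sum_v p v = 1 ->
  exists P : probability (discrete_space x0) R, mass P =1 p.
Proof.
move=> p0 p1.
pose x k : discrete_space x0 := nth x0 (enum T) k.
(* A weighted sum of Dirac measures along an enumeration of [T]; the default of [nth] is never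
   reached below [#|T|]. *)
pose mu : {measure set (discrete_space x0) -> \bar R} :=
  msum (fun k => mscale (NngNum (p0 (x k))) (dirac (x k))) #|T|.
have muE (A : set (discrete_space x0)) : mu A = (\sum_(v | v \in A) p v)%:E.
  rewrite /mu /= /msum -sumEFin [RHS]big_mkcond /=.
  rewrite -(big_enum _ _ _ (fun v => if v \in A then (p v)%:E else 0%E)) /=.
  rewrite (big_nth x0) big_mkord -cardT; apply: eq_bigr => k _.
  rewrite /mscale /= diracE.
  by rewrite /x; case: ifP => _; rewrite ?mule1 ?mule0.
have mu1 : mu setT = 1%E.
  by rewrite muE -p1; congr EFin; apply: eq_bigl => v; rewrite in_setT.
pose P := HB.pack_for (probability (discrete_space x0) R) (Measure.sort mu)
  (Measure_isProbability.Build _ _ _ mu mu1).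
exists P => v.
rewrite /mass [P _]muE /= (big_pred1 v) // => w /=.
by apply/idP/eqP => [/set_mem//|->]; apply/mem_set.
Qed.

End DiscreteProbability.

(** * The stochastic order read off from upper sides *)

Section StochasticOrder.
Import Order.TTheory GRing.Theory Num.Theory.
Local Open Scope ring_scope.

Context {R : realType} {d : Order.disp_t} {S : finPOrderType d} {x0 : S}.
Implicit Types P Q : probability (discrete_space x0) R.

Lemma stoch_le_upper_side P Q e : stoch_le P Q -> edge e ->
  \sum_(v in upper_side e) mass P v <= \sum_(v in upper_side e) mass Q v.
Proof.
by move=> PQ ee; rewrite -lee_fin -!probability_mass; apply/PQ/upper_side_up_set.
Qed.

Lemma upper_side_stoch_le P Q : ~ has_cycle S -> connected_poset S ->
  (forall e, edge e ->
    \sum_(v in upper_side e) mass P v <= \sum_(v in upper_side e) mass Q v) ->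
  stoch_le P Q.
Proof.
move=> acyclic connS PQ U upU.
have -> : U = [set` [set v | `[< U v >]]%SET]%classic.
  by apply/seteqP; split=> v /=; rewrite inE => /asboolP.
rewrite !probability_mass lee_fin; apply: up_set_le => //; first by rewrite !sum_mass.
by move=> x y; rewrite !finset.inE => /asboolP Ux xy; apply/asboolP; exact: (upU x y).
Qed.

End StochasticOrder.

Theorem proposition5p2 (R : realType) (d : Order.disp_t) (S : finPOrderType d)
    (x0 : S) (connS : connected_poset S) (notB : ~ classB S)
    (m n : nat) (m_gt0 : (0 < m)%N) (n_gt0 : (0 < n)%N)
    (Pa : 'I_m -> probability (discrete_space x0) R)
    (Pb : 'I_n -> probability (discrete_space x0) R)
    (PaPb : forall (i : 'I_m) (j : 'I_n), stoch_le (Pa i) (Pb j)) :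
  exists P0 : probability (discrete_space x0) R,
    forall (i : 'I_m) (j : 'I_n), stoch_le (Pa i) P0 /\ stoch_le P0 (Pb j).
Proof.
have acyclic : ~ has_cycle S by move=> c; apply: notB; split=> //; left.
have no_bowtie : ~ has_induced S bowtie by move=> c; apply: notB; split=> //; right.
have [p [p0 p1 between]] := exists_mass_between acyclic connS no_bowtie
  (Ordinal m_gt0) (Ordinal n_gt0)
  (fun i => mass_ge0 (Pa i)) (fun i => sum_mass (Pa i))
  (fun j => mass_ge0 (Pb j)) (fun j => sum_mass (Pb j))
  (fun i j e => @stoch_le_upper_side _ _ _ _ _ _ e (PaPb i j)).
have [P Pp] := mass_probability (x0 := x0) p0 p1.
have PE e : (\sum_(v in upper_side e) mass P v = \sum_(v in upper_side e) p v)%R.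
  by apply: eq_bigr.
by exists P => i j; split; apply: upper_side_stoch_le => // e ee;
  rewrite PE; case/andP: (between i j e ee).
Qed.
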